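(* There is a computable distributive algebraic lattice for which the set of compact elements is complete $\Pi^0_3$.
   Context: A computable lattice $(L,\preceq)$ has underlying set $L=\omega$ and a computable lattice ordering $\preceq$, formally a computable subset of $\omega^2$. A lattice is complete if every subset has both a supremum and an infimum. An element $a\in L$ is compact if for each subset $S\subseteq L$, if $a\preceq\sup S$ then there is a finite subset $S'\subseteq S$ such that $a\preceq\sup S'$. A lattice is compactly generated if every element is the supremum of a set of compact elements, and algebraic if it is complete and compactly generated. A set is complete $\Pi^0_3$ if it is $\Pi^0_3$ and every $\Pi^0_3$ subset of $\omega$ is $m$-reducible to it. *)

(* Defs.v *)
From mathcomp Require Import all_boot all_order.
From mathcomp Require Import classical_sets cardinality.
From Stdlib Require Cantor.

Set Implicit Arguments.
Unset Strict Implicit.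
Unset Printing Implicit Defensive.

Local Open Scope classical_set_scope.

(** * Computability *)

Definition npair (x y : nat) : nat := Cantor.to_nat (x, y).
Definition nfst (n : nat) : nat := (Cantor.of_nat n).1.
Definition nsnd (n : nat) : nat := (Cantor.of_nat n).2.

(* Kleene's partial recursive functions, presented as unary functions: several
   arguments are packed in one number by [npair], which together with its two
   projections is therefore among the initial functions. *)
Inductive code : Type :=
  | CZero
  | CSucc
  | CFst
  | CSnd
  | CPair of code & code
  | CComp of code & code
  | CPrec of code & code
  | CMu of code.

(* The graph of h where h(a, 0) = f(a) and h(a, n+1) = g(a, (n, h(a, n))). *)
Fixpoint prec_graph (f g : nat -> nat -> Prop) (a n y : nat) : Prop :=
  match n with
  | 0 => f a y
  | n'.+1 => exists2 z, prec_graph f g a n' z & g (npair a (npair n' z)) y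
  end.

(* [eval c x y]: the partial function with code c is defined at x, with
   value y. *)
Fixpoint eval (c : code) (x y : nat) : Prop :=
  match c with
  | CZero => y = 0
  | CSucc => y = x.+1
  | CFst => y = nfst x
  | CSnd => y = nsnd x
  | CPair f g => exists a b, [/\ eval f x a, eval g x b & y = npair a b]
  | CComp f g => exists2 z, eval g x z & eval f z y
  | CPrec f g => prec_graph (eval f) (eval g) (nfst x) (nsnd x) y
  | CMu f => eval f (npair x y) 0 /\
             forall k, k < y -> exists v, eval f (npair x k) v.+1
  end.

Definition computable (f : nat -> nat) : Prop :=
  exists c, forall x, eval c x (f x).

Definition computable_pred (P : pred nat) : Prop :=
  computable (fun x => nat_of_bool (P x)).

Definition computable_rel (R : rel nat) : Prop :=
  computable_pred (fun n => R (nfst n) (nsnd n)).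

Definition Pi03 (A : set nat) : Prop :=
  exists2 R : pred nat, computable_pred R &
    forall n, A n <->
      forall x, exists y, forall z, R (npair n (npair x (npair y z))).

Definition m_reducible (A B : set nat) : Prop :=
  exists2 f : nat -> nat, computable f & forall n, A n <-> B (f n).

Definition Pi03_complete (B : set nat) : Prop :=
  Pi03 B /\ forall A, Pi03 A -> m_reducible A B.

(** * Algebraic lattices *)

Section AlgebraicLattice.
Context {d : Order.disp_t} (L : latticeType d).

Definition complete_lattice : Prop :=
  forall S : set L, supremums S !=set0 /\ infimums S !=set0.

(* Suprema are described by the predicate [supremums]; they are unique, and
   they exist when L is complete. *)
Definition compact_element (a : L) : Prop :=
  forall (S : set L) (s : L), supremums S s -> (a <= s)%O ->
    exists S' : set L, [/\ finite_set S', S' `<=` S &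
      exists2 s', supremums S' s' & (a <= s')%O].

Definition compactly_generated : Prop :=
  forall x : L, exists2 C : set L, C `<=` compact_element & supremums C x.

Definition algebraic_lattice : Prop :=
  complete_lattice /\ compactly_generated.

End AlgebraicLattice.

(* Main.v *)
Require Import Defs.
From HB Require Import structures.
From mathcomp Require Import all_boot all_order.
From mathcomp Require Import boolp classical_sets cardinality.
From mathcomp Require Import zify.
From Stdlib Require Cantor.

Set Implicit Arguments.
Unset Strict Implicit.
Unset Printing Implicit Defensive.

(** The lattice is a countable topology ordered by inclusion; unions are
    suprema, so it is a complete distributive lattice, and its compact elements
    are the compact open sets.

    Let P n c be decidable sets of numbers. The space has points (n, c, v): for
    every level n a sequence of columns c, and in column c of level n one point
    for each number v. A column is ordered like a subset of the integers: the
    numbers outside P n c come first, in decreasing order, and the numbers in P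
    n c follow, in increasing order. So the column has a greatest point (or no
    point in P n c, and then 0 is greatest) if P n c is finite, and it has
    cofinality omega if P n c is infinite. An open set, other than the empty
    set and the whole space, contains all levels below some n, nothing above n,
    and in level n all columns in full except finitely many, which it cuts at
    the initial segment strictly below some point. Every union of such sets is
    of this form again (union_open), because an unbounded family of cuts in a
    column exhausts the column. The finite data of an open set are coded
    bijectively by numbers, and inclusion of open sets only compares finitely
    many cuts, so it is computable if P is.

    In the open set that contains level n in full, a column with finite P n c
    is covered by any member of a cover that contains its greatest point, while
    a column with infinite P n c can be covered by cuts no finite number of
    which suffice. One member of a cover already contains all but finitely many
    columns. Hence a nonempty open set of level n is compact if and only if P n
    c is finite for every column c that it contains in full (compact_elementP),
    which is a Pi03 condition.

    If at most one P n c is infinite for each n, then each open set is a union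
    of compact ones: cut that column at higher and higher points. So the
    lattice is algebraic, and the set of those n for which level n in full is
    compact is the set of n such that P n c is finite for all c. It remains to
    write every Pi03 set in this form, uniformly (Pi03_complete_bounded). A
    universal machine (universal_Pi03) gives one decidable Q such that every
    Pi03 set is given by forall x, exists y, forall w, Q (npair e n) x y w for
    some e. For each x the condition on y fails if and only if an increasing
    search for counterexamples makes progress infinitely often
    (progress_bounded). To have a single infinite column, the search for x is
    restarted, under a new column name, whenever the search for a smaller x
    makes progress: only the least x whose search succeeds infinitely often is
    then restarted finitely often and still progresses for ever
    (stable_unbounded_unique, stable_bounded). *)

(** * Closure properties of computable functions *)

Arguments npair : simpl never.
Arguments nfst : simpl never.
Arguments nsnd : simpl never.

Lemma nfst_npair x y : nfst (npair x y) = x.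
Proof. by rewrite /nfst /npair Cantor.cancel_of_to. Qed.

Lemma nsnd_npair x y : nsnd (npair x y) = y.
Proof. by rewrite /nsnd /npair Cantor.cancel_of_to. Qed.

Lemma npair_nfst_nsnd n : npair (nfst n) (nsnd n) = n.
Proof.
by rewrite /npair /nfst /nsnd -surjective_pairing Cantor.cancel_to_of.
Qed.

Definition npairE := (nfst_npair, nsnd_npair).

Lemma eq_computable f g : f =1 g -> computable f -> computable g.
Proof. by move=> fg [c cf]; exists c => x; rewrite -fg. Qed.

Lemma computable_comp f g :
  computable f -> computable g -> computable (fun x => f (g x)).
Proof. by move=> [c cf] [e eg]; exists (CComp c e) => x; exists (g x). Qed.

Lemma computable_npair f g :
  computable f -> computable g -> computable (fun x => npair (f x) (g x)).
Proof.
by move=> [c cf] [e eg]; exists (CPair c e) => x; exists (f x), (g x).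
Qed.

Lemma computable_nfst f : computable f -> computable (fun x => nfst (f x)).
Proof. by apply: computable_comp; exists CFst. Qed.

Lemma computable_nsnd f : computable f -> computable (fun x => nsnd (f x)).
Proof. by apply: computable_comp; exists CSnd. Qed.

Lemma computable_succ f : computable f -> computable (fun x => (f x).+1).
Proof. by apply: computable_comp; exists CSucc. Qed.

Lemma computable_id : computable (fun x => x).
Proof.
apply: (eq_computable npair_nfst_nsnd).
by apply: computable_npair; [exists CFst|exists CSnd].
Qed.

Lemma computable_const k : computable (fun=> k).
Proof. by elim: k => [|k IH]; [exists CZero|apply: computable_succ]. Qed.

Lemma computable2 (F : nat -> nat -> nat) f g :
  computable (fun w => F (nfst w) (nsnd w)) -> computable f -> computable g ->
  computable (fun x => F (f x) (g x)).
Proof.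
move=> cF cf cg.
apply: (eq_computable _ (computable_comp cF (computable_npair cf cg))) => x /=.
by rewrite !npairE.
Qed.

Lemma computable_pred2 (p : rel nat) f g :
  computable_pred (fun w => p (nfst w) (nsnd w)) ->
  computable f -> computable g -> computable_pred (fun x => p (f x) (g x)).
Proof. exact: (computable2 (F := fun a b => nat_of_bool (p a b))). Qed.

Lemma computable_nat_rec (b n : nat -> nat) (G : nat -> nat -> nat -> nat) :
  computable b -> computable n ->
  computable (fun w => G (nfst w) (nfst (nsnd w)) (nsnd (nsnd w))) ->
  computable (fun x => nat_rec (fun=> nat) (b x) (G x) (n x)).
Proof.
move=> [c cb] cn [e eG].
pose F a k := nat_rec (fun=> nat) (b a) (G a) k.
suff cF : computable (fun w => F (nfst w) (nsnd w)).
  exact: (computable2 cF computable_id cn).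
exists (CPrec c e) => w /=; elim: (nsnd w) => [|k IH] /=; first exact: cb.
exists (F (nfst w) k) => //.
by have := eG (npair (nfst w) (npair k (F (nfst w) k))); rewrite !npairE.
Qed.

(** Each closure lemma is stated for functions of one ambient argument, so that
    proof search on the syntax of a function body finds a program for it.  Under
    a binder (recursion, iteration, bounded quantifiers) the ambient argument
    becomes a pair, which the lemmas on the two projections handle. *)
Create HintDb computability.
#[local] Hint Resolve computable_npair computable_nfst computable_nsnd
  computable_succ computable_id computable_const computable_nat_rec
  : computability.
(* Calls of functions that a hypothesis says to be computable. *)
#[local] Hint Extern 2 (computable _) =>
  match goal with H : computable ?f |- computable (fun x => ?f (@?g x)) =>
    apply: (computable_comp H) end : computability.
Ltac computability := solve [auto 40 with computability nocore].

Lemma computable_iter (b n : nat -> nat) (G : nat -> nat -> nat) :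
  computable b -> computable n ->
  computable (fun w => G (nfst w) (nsnd w)) ->
  computable (fun x => iter (n x) (G x) (b x)).
Proof.
move=> cb cn cG.
apply: (@eq_computable (fun x => nat_rec (fun=> nat) (b x) (fun=> G x) (n x))).
  by move=> x; elim: (n x) => //= k ->.
apply: computable_nat_rec => //; apply: computable2 => //; computability.
Qed.

Lemma computable_predn f :
  computable f -> computable (fun x => (f x).-1).
Proof.
move=> cf; apply: (@eq_computable
  (fun x => nat_rec (fun=> nat) 0 (fun k _ => k) (f x))); last by computability.
by move=> x; case: (f x).
Qed.

Lemma computable_if (p : pred nat) f g :
  computable_pred p -> computable f -> computable g ->
  computable (fun x => if p x then f x else g x).
Proof.
move=> cp cf cg; apply: (@eq_computable
  (fun x => nat_rec (fun=> nat) (g x) (fun _ _ => f x) (p x))).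
  by move=> x; case: (p x).
apply: computable_nat_rec => //; apply: computable_comp => //; computability.
Qed.

Lemma computable_andb (p q : pred nat) :
  computable_pred p -> computable_pred q ->
  computable_pred (fun x => p x && q x).
Proof.
move=> cp cq.
apply: (@eq_computable (fun x => if p x then nat_of_bool (q x) else 0)).
  by move=> x; case: (p x).
by apply: computable_if => //; computability.
Qed.

Lemma computable_negb (p : pred nat) :
  computable_pred p -> computable_pred (fun x => ~~ p x).
Proof.
move=> cp; apply: (@eq_computable (fun x => if p x then 0 else 1)).
  by move=> x; case: (p x).
by apply: computable_if => //; computability.
Qed.

Lemma computable_orb (p q : pred nat) :
  computable_pred p -> computable_pred q ->
  computable_pred (fun x => p x || q x).
Proof.
move=> cp cq.
apply: (@eq_computable (fun x => if p x then 1 else nat_of_bool (q x))).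
  by move=> x; case: (p x).
by apply: computable_if => //; computability.
Qed.

Lemma computable_implyb (p q : pred nat) :
  computable_pred p -> computable_pred q ->
  computable_pred (fun x => p x ==> q x).
Proof.
move=> cp cq.
apply: (@eq_computable (fun x => if p x then nat_of_bool (q x) else 1)).
  by move=> x; case: (p x).
by apply: computable_if => //; computability.
Qed.

Lemma computable_pred_if (p q r : pred nat) :
  computable_pred p -> computable_pred q -> computable_pred r ->
  computable_pred (fun x => if p x then q x else r x).
Proof.
move=> cp cq cr; apply: (eq_computable _ (computable_if cp cq cr)) => x /=.
by case: (p x).
Qed.

#[local] Hint Resolve computable_iter computable_predn computable_if
  computable_andb computable_negb computable_orb computable_implyb
  computable_pred_if : computability.

Lemma computable_add f g :
  computable f -> computable g -> computable (fun x => f x + g x).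
Proof.
move=> cf cg.
apply: (@eq_computable (fun x => iter (f x) (fun z => z.+1) (g x))).
  by move=> x; elim: (f x) => //= k ->.
computability.
Qed.

Lemma computable_leq f g :
  computable f -> computable g -> computable_pred (fun x => f x <= g x).
Proof.
move=> cf cg; apply: (@eq_computable
  (fun x => nat_rec (fun=> nat) 1 (fun _ _ => 0) (iter (g x) predn (f x)))).
  move=> x; suff -> : iter (g x) predn (f x) = f x - g x.
    by rewrite -subn_eq0; case: (f x - g x).
  by elim: (g x) => [|k /= ->]; rewrite ?subn0 ?subnS.
computability.
Qed.

#[local] Hint Resolve computable_add computable_leq : computability.

Lemma computable_eqn f g :
  computable f -> computable g -> computable_pred (fun x => f x == g x).
Proof.
move=> cf cg; apply: (@eq_computable
  (fun x => nat_of_bool ((f x <= g x) && (g x <= f x)))).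
  by move=> x; rewrite eqn_leq.
suff: computable_pred (fun x => (f x <= g x) && (g x <= f x)) by [].
computability.
Qed.

Lemma computable_all (p : rel nat) n :
  computable_pred (fun w => p (nfst w) (nsnd w)) -> computable n ->
  computable_pred (fun x => all (p x) (iota 0 (n x))).
Proof.
move=> cp cn; apply: (@eq_computable
  (fun x => nat_rec (fun=> nat) 1 (fun k z => if p x k then z else 0) (n x))).
  move=> x; elim: (n x) => [//|k IH].
  rewrite -[in iota 0 _]addn1 iotaD all_cat /= andbT.
  by rewrite IH; case: (p x k); rewrite ?andbT ?andbF.
have cp' : computable_pred (fun w => p (nfst w) (nfst (nsnd w))).
  by apply: (computable_pred2 cp); computability.
computability.
Qed.

Lemma computable_has (p : rel nat) n :
  computable_pred (fun w => p (nfst w) (nsnd w)) -> computable n ->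
  computable_pred (fun x => has (p x) (iota 0 (n x))).
Proof.
move=> cp cn; apply: (@eq_computable
  (fun x => nat_of_bool (~~ all (fun k => ~~ p x k) (iota 0 (n x))))).
  by move=> x; rewrite -has_predC; congr nat_of_bool; apply: eq_has => k /=;
    rewrite negbK.
apply: computable_negb.
apply: (computable_all (p := fun x k => ~~ p x k)) => //.
exact: computable_negb.
Qed.

#[local] Hint Resolve computable_eqn computable_all computable_has
  : computability.

(** * A universal machine *)

(** Selection from a list of alternatives by an index: this lets the transition
    table of the machine below be written as a list. *)
Lemma computable_nth_nil d n : computable d -> computable n ->
  computable (fun x => nth (d x) [::] (n x)).
Proof. by move=> cd _; apply: (eq_computable _ cd) => x; rewrite nth_nil. Qed.

Lemma computable_nth_cons (s : nat -> seq nat) d a n :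
  computable a -> computable n ->
  computable (fun x => nth (d x) (s x) (n x).-1) ->
  computable (fun x => nth (d x) (a x :: s x) (n x)).
Proof.
move=> ca cn cs; apply: (@eq_computable
  (fun x => if n x == 0 then a x else nth (d x) (s x) (n x).-1)).
  by move=> x; case: (n x).
computability.
Qed.

#[local] Hint Resolve computable_nth_nil computable_nth_cons : computability.

(** The machine runs on numbers.  A state is npair k (npair x d), where k is the
    stack of pending instructions (0 is the empty stack), x the current value
    and d a stack of saved values.  An instruction is an operation number paired
    with an argument; operations 0 to 7 are the constructors of codes. *)
Definition push i k := (npair i k).+1.

Fixpoint instr (c : code) : nat :=
  match c with
  | CZero => npair 0 0
  | CSucc => npair 1 0
  | CFst => npair 2 0
  | CSnd => npair 3 0
  | CPair f g => npair 4 (npair (instr f) (instr g))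
  | CComp f g => npair 5 (npair (instr f) (instr g))
  | CPrec f g => npair 6 (npair (instr f) (instr g))
  | CMu f => npair 7 (instr f)
  end.

(** The other operations finish what a compound code began: exchange the value
    with the last saved one, pair them, and test whether a loop has ended.  The
    loops save the parameter and the counter, and for primitive recursion also
    the bound. *)
Definition swap_instr := npair 8 0.
Definition pair_instr := npair 9 0.
Definition prec_loop g := npair 10 g.
Definition mu_loop f := npair 11 f.

Definition exec (op arg k x d : nat) : nat :=
  nth 0 [::
    (* CZero *) npair k (npair 0 d);
    (* CSucc *) npair k (npair x.+1 d);
    (* CFst *) npair k (npair (nfst x) d);
    (* CSnd *) npair k (npair (nsnd x) d);
    (* CPair *) npair
      (push (nfst arg) (push swap_instr (push (nsnd arg) (push pair_instr k))))
      (npair x (npair x d));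
    (* CComp *) npair (push (nsnd arg) (push (nfst arg) k)) (npair x d);
    (* CPrec *) npair (push (nfst arg) (push (prec_loop (nsnd arg)) k))
      (npair (nfst x) (npair (npair (nfst x) (npair 0 (nsnd x))) d));
    (* CMu *) npair (push arg (push (mu_loop arg) k))
      (npair (npair x 0) (npair (npair x 0) d));
    (* swap_instr *) npair k (npair (nfst d) (npair x (nsnd d)));
    (* pair_instr *) npair k (npair (npair (nfst d) x) (nsnd d));
    (* prec_loop *)
      let a := nfst (nfst d) in
      let i := nfst (nsnd (nfst d)) in
      let n := nsnd (nsnd (nfst d)) in
      if i == n then npair k (npair x (nsnd d)) else
      npair (push arg (push (prec_loop arg) k))
        (npair (npair a (npair i x)) (npair (npair a (npair i.+1 n)) (nsnd d)));
    (* mu_loop *)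
      let a := nfst (nfst d) in
      let i := nsnd (nfst d) in
      if x == 0 then npair k (npair i (nsnd d)) else
      npair (push arg (push (mu_loop arg) k))
        (npair (npair a i.+1) (npair (npair a i.+1) (nsnd d)))
  ] op.

Definition step (s : nat) : nat :=
  if nfst s == 0 then s else
  let i := nfst (nfst s).-1 in
  exec (nfst i) (nsnd i) (nsnd (nfst s).-1) (nfst (nsnd s)) (nsnd (nsnd s)).

Lemma computable_exec op arg k x d :
  computable op -> computable arg -> computable k -> computable x ->
  computable d ->
  computable (fun w => exec (op w) (arg w) (k w) (x w) (d w)).
Proof.
move=> cop carg ck cx cd.
rewrite /exec /push /prec_loop /mu_loop /swap_instr /pair_instr.
computability.
Qed.
#[local] Hint Resolve computable_exec : computability.

Lemma computable_step : computable step.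
Proof. rewrite /step; computability. Qed.

Definition reaches s t := exists n, iter n step s = t.

Lemma reaches_refl s : reaches s s. Proof. by exists 0. Qed.

Lemma reaches_trans t s u : reaches s t -> reaches t u -> reaches s u.
Proof. by move=> [m <-] [n <-]; exists (n + m); rewrite iterD. Qed.

Lemma reaches_step s u : reaches (step s) u -> reaches s u.
Proof. by move=> [n <-]; exists n.+1; rewrite iterSr. Qed.

Lemma step_push op arg k x d :
  step (npair (push (npair op arg) k) (npair x d)) = exec op arg k x d.
Proof. by rewrite /step !npairE. Qed.

(** Runs are only followed in the direction from evaluation to the machine: the
    machine is deterministic, so for a total code this already determines its
    result. *)
Lemma eval_reaches c x y : eval c x y -> forall k d,
  reaches (npair (push (instr c) k) (npair x d)) (npair k (npair y d)).
Proof.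
elim: c x y => [||||f IHf g IHg|f IHf g IHg|f IHf g IHg|f IHf] x y /=.
- by move=> -> k d; apply: reaches_step; rewrite step_push; apply: reaches_refl.
- by move=> -> k d; apply: reaches_step; rewrite step_push; apply: reaches_refl.
- by move=> -> k d; apply: reaches_step; rewrite step_push; apply: reaches_refl.
- by move=> -> k d; apply: reaches_step; rewrite step_push; apply: reaches_refl.
- move=> [a [b [fa gb ->]]] k d; apply: reaches_step.
  rewrite step_push /exec /= !npairE.
  apply: reaches_trans (IHf _ _ fa _ _) _; apply: reaches_step.
  rewrite step_push /exec /= !npairE.
  apply: reaches_trans (IHg _ _ gb _ _) _; apply: reaches_step.
  rewrite step_push /exec /= !npairE; exact: reaches_refl.
- move=> [z gz fy] k d; apply: reaches_step.
  rewrite step_push /exec /= !npairE.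
  exact: reaches_trans (IHg _ _ gz _ _) (IHf _ _ fy _ _).
- move=> h k d; apply: reaches_step; rewrite step_push /exec /= !npairE.
  have loop i z : i <= nsnd x -> prec_graph (eval f) (eval g) (nfst x) i z ->
    reaches (npair (push (instr f) (push (prec_loop (instr g)) k))
              (npair (nfst x) (npair (npair (nfst x) (npair 0 (nsnd x))) d)))
            (npair (push (prec_loop (instr g)) k)
              (npair z (npair (npair (nfst x) (npair i (nsnd x))) d))).
    elim: i z => [|i IHi] z ltin /=; first by move=> fz; apply: IHf.
    move=> [t it gz]; apply: reaches_trans (IHi _ (ltnW ltin) it) _.
    apply: reaches_step; rewrite step_push /exec /= !npairE ltn_eqF //.
    exact: IHg.
  apply: reaches_trans (loop _ _ (leqnn _) h) _; apply: reaches_step.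
  rewrite step_push /exec /= !npairE eqxx; exact: reaches_refl.
- move=> [fy lty] k d; apply: reaches_step; rewrite step_push /exec /=.
  have loop i : i <= y ->
    reaches (npair (push (instr f) (push (mu_loop (instr f)) k))
              (npair (npair x 0) (npair (npair x 0) d)))
            (npair (push (instr f) (push (mu_loop (instr f)) k))
              (npair (npair x i) (npair (npair x i) d))).
    elim: i => [_|i IHi ltiy]; first exact: reaches_refl.
    apply: reaches_trans (IHi (ltnW ltiy)) _.
    have [v fv] := lty _ ltiy; apply: reaches_trans (IHf _ _ fv _ _) _.
    apply: reaches_step; rewrite step_push /exec /= !npairE.
    exact: reaches_refl.
  apply: reaches_trans (loop _ (leqnn _)) _.
  apply: reaches_trans (IHf _ _ fy _ _) _; apply: reaches_step.
  rewrite step_push /exec /= !npairE; exact: reaches_refl.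
Qed.

(** Value 0 is the one of interest: a code of a decidable predicate returns it
    where the predicate fails. *)
Definition halts0 (e x t : nat) : bool :=
  let s := iter t step (npair (push e 0) (npair x 0)) in
  (nfst s == 0) && (nfst (nsnd s) == 0).

Lemma halts0P c (f : nat -> nat) : (forall x, eval c x (f x)) ->
  forall x, f x = 0 <-> exists t, halts0 (instr c) x t.
Proof.
move=> cf x; have [t runt] := eval_reaches (cf x) 0 0.
split=> [fx0|[u]]; first by exists t; rewrite /halts0 runt fx0 !npairE.
rewrite /halts0.
set s0 := npair _ _ in runt * => /andP[/eqP halt /eqP out].
(* A stopped state is a fixed point, so the two runs end in the same state. *)
have halted s n : nfst s = 0 -> iter n step s = s.
  by move=> s0'; elim: n => //= n ->; rewrite /step s0' eqxx.
have := out; case: (leqP t u) => [/subnK <-|/ltnW/subnK tu].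
  by rewrite iterD runt halted ?npairE.
by have := runt; rewrite -tu iterD halted // => ->; rewrite !npairE.
Qed.

Lemma computable_halts0 e x t :
  computable e -> computable x -> computable t ->
  computable_pred (fun w => halts0 (e w) (x w) (t w)).
Proof.
move=> ce cx ct; have cstep := computable_step.
rewrite /halts0 /push; computability.
Qed.
#[local] Hint Resolve computable_halts0 : computability.

(** A decidable matrix R holds where no run of its code stops with value 0.  The
    additional universal quantifier over running times merges with the
    innermost one. *)
Theorem universal_Pi03 : exists2 Q : nat -> nat -> nat -> nat -> bool,
  (forall i x y w, computable i -> computable x -> computable y ->
     computable w ->
     computable_pred (fun u => Q (i u) (x u) (y u) (w u))) &
  forall A, Pi03 A -> exists e, forall n,
    A n <-> forall x, exists y, forall w, Q (npair e n) x y w.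
Proof.
(* w codes the pair of the original innermost variable and a running time. *)
exists (fun i x y w =>
  ~~ halts0 (nfst i) (npair (nsnd i) (npair x (npair y (nfst w)))) (nsnd w)).
  by move=> i x y w ci cx cy cw; computability.
move=> A [R [c cR] AR]; exists (instr c) => n; rewrite AR.
have R0 := halts0P cR.
split=> h x; have [y hy] := h x; exists y => z.
  rewrite !npairE; apply/negP => hz.
  have /R0 : exists t,
      halts0 (instr c) (npair n (npair x (npair y (nfst z)))) t.
    by exists (nsnd z).
  by rewrite hy.
case: (boolP (R _)) => // /negbTE Rz.
have [t ht] : exists t, halts0 (instr c) (npair n (npair x (npair y z))) t.
  by apply/R0; rewrite Rz.
by have := hy (npair z t); rewrite !npairE ht.
Qed.

(** * Pi03 sets as families of finite sets *)

Definition bounded (p : pred nat) := exists N, forall v, p v -> v < N.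

Lemma sub_bounded (p q : pred nat) :
  (forall v, p v -> q v) -> bounded q -> bounded p.
Proof. by move=> pq [N qN]; exists N => v /pq /qN. Qed.

Lemma bounded_lt (p : nat -> pred nat) n :
  (forall k, k < n -> bounded (p k)) ->
  exists N, forall k v, k < n -> p k v -> v < N.
Proof.
elim: n => [|n IH] pb; first by exists 0.
have [N hN] := IH (fun k kn => pb k (ltnW kn)).
have [M hM] := pb n (leqnn _).
exists (maxn N M) => k v; rewrite ltnS leq_eqVlt leq_max.
by case/orP => [/eqP ->/hM ->|kn /(hN _ _ kn) ->]; rewrite ?orbT.
Qed.

Lemma nat_minimal (p : nat -> Prop) : (exists n, p n) ->
  exists2 n, p n & forall m, p m -> n <= m.
Proof.
move=> [n pn]; have ex : exists n, `[< p n >] by exists n; apply/asboolP.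
case: (ex_minnP ex) => m /asboolP pm minm; exists m => // k pk.
by apply: minm; apply/asboolP.
Qed.

Lemma nfst_le v : nfst v <= v.
Proof.
have := Cantor.to_nat_spec (nfst v) (nsnd v).
rewrite -/(npair _ _) npair_nfst_nsnd; nia.
Qed.

(** The search for counterexamples treats all y' <= y at once, so that it is
    stuck for ever from the first y' on that has none; s bounds them. *)
Definition witnessed (Q : nat -> nat -> bool) y s :=
  all (fun y' => has (fun w => ~~ Q y' w) (iota 0 s.+1)) (iota 0 y.+1).

(** Stage v = npair y s makes progress if s is the least bound at which the
    search for y succeeds.  So each y contributes at most one stage. *)
Definition progress (Q : nat -> nat -> bool) v :=
  witnessed Q (nfst v) (nsnd v) &&
  all (fun s => ~~ witnessed Q (nfst v) s) (iota 0 (nsnd v)).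

Lemma witnessedP Q y s :
  reflect (forall y', y' <= y -> exists2 w, w <= s & ~~ Q y' w)
    (witnessed Q y s).
Proof.
apply: (iffP allP) => h y'; last first.
  rewrite mem_iota => /h [w ws Qw].
  by apply/hasP; exists w; rewrite // mem_iota.
move=> y'y; have /h/hasP[w] : y' \in iota 0 y.+1 by rewrite mem_iota.
by rewrite mem_iota => ws Qw; exists w.
Qed.

(** If some y0 has no counterexample, only the finitely many y < y0 contribute a
    stage; otherwise every y contributes one, and stages are at least y. *)
Lemma progress_bounded Q :
  bounded (progress Q) <-> exists y, forall w, Q y w.
Proof.
split=> [[N hN]|[y0 hy0]].
  apply: contrapT => noy.
  have wit y : exists w, ~~ Q y w.
    apply: contrapT => now; apply: noy; exists y => w.
    by apply/negPn/negP => Qw; apply: now; exists w.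
  have exgood y : exists s, witnessed Q y s.
    elim: y => [|y [s /witnessedP gs]].
      by have [w Qw] := wit 0; exists w; apply/witnessedP => -[|//] _; exists w.
    have [w Qw] := wit y.+1; exists (maxn s w); apply/witnessedP => y'.
    rewrite leq_eqVlt => /orP[/eqP ->|/gs [u us Qu]].
      by exists w; rewrite // leq_maxr.
    by exists u; rewrite // leq_max us.
  have [s gs mins] := nat_minimal (exgood N).
  have : npair N s < N.
    apply: hN; rewrite /progress !npairE gs; apply/allP => t.
    by rewrite mem_iota /= add0n => ts; apply/negP => /mins; rewrite leqNgt ts.
  have := nfst_le (npair N s); rewrite nfst_npair => /leq_ltn_trans h /h.
  by rewrite ltnn.
have [N hN] : exists N, forall y v, y < y0 ->
    (fun v => (nfst v == y) && progress Q v) v -> v < N.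
  apply: (bounded_lt (p := fun y v => (nfst v == y) && progress Q v)) => y _.
  have [[v /andP[/eqP vy /andP[gv minv]]]|none] :=
    pselect (exists v, (nfst v == y) && progress Q v); last first.
    by exists 0 => v hv; case: none; exists v.
  exists v.+1 => u /andP[/eqP uy /andP[gu minu]]; rewrite ltnS.
  suff -> : u = v by [].
  have eq1 : nfst u = nfst v by rewrite uy.
  rewrite -(npair_nfst_nsnd u) -(npair_nfst_nsnd v) eq1; congr npair.
  case: (ltngtP (nsnd u) (nsnd v)) => // lt.
    move/allP: minv => /(_ (nsnd u)).
    by rewrite mem_iota lt -eq1 gu => /(_ isT).
  move/allP: minu => /(_ (nsnd v)).
  by rewrite mem_iota lt eq1 gv => /(_ isT).
exists N => v pv; apply: (hN (nfst v)); rewrite ?eqxx //= ltnNge.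
case/andP: pv => /witnessedP gv _; apply/negP => /gv [w _].
by rewrite hy0.
Qed.

(** The number c = npair x r names the run of x that starts at stage r because a
    smaller x' made progress just before (or r = 0), and that ends at the next
    progress of a smaller x'; stable_progress prog c holds at the stages of
    progress of x during that run.  Naming a run by its exact starting
    stage is what makes the infinite run unique. *)
Definition stable_progress (prog : nat -> pred nat) c v :=
  [&& prog (nfst c) v, nsnd c <= v,
      all (fun u => (nsnd c <= u) ==>
        all (fun x => ~~ prog x u) (iota 0 (nfst c))) (iota 0 v) &
      (nsnd c == 0) || has (fun x => prog x (nsnd c).-1) (iota 0 (nfst c))].

Lemma stable_unbounded prog c : ~ bounded (stable_progress prog c) ->
  [/\ ~ bounded (prog (nfst c)),
      forall x u, x < nfst c -> nsnd c <= u -> ~~ prog x u &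
      nsnd c = 0 \/ exists2 x, x < nfst c & prog x (nsnd c).-1].
Proof.
move=> unb; split.
- by apply: contra_not unb; apply: sub_bounded => v /and4P[].
- move=> x u xc cu; apply: contrapT => /negP/negPn pxu; apply: unb.
  exists u.+1 => v /and4P[_ _ /allP nop _]; rewrite ltnNge; apply/negP => uv.
  move: (nop u); rewrite mem_iota uv cu /= => /(_ isT) /allP /(_ x).
  by rewrite mem_iota xc pxu => /(_ isT).
- apply: contrapT => h; apply: unb; exists 0 => v /and4P[_ _ _].
  case/orP => [/eqP r0|/hasP [x]]; first by case: h; left.
  by rewrite mem_iota => xc px; case: h; right; exists x.
Qed.

(** Take two infinite runs. If they belonged to different x, the smaller one
    would make infinitely much progress and thereby end the run of the larger
    one. For the same x the later run starts with an interruption of the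
    earlier one. *)
Lemma stable_unbounded_unique prog c c' :
  ~ bounded (stable_progress prog c) -> ~ bounded (stable_progress prog c') ->
  c = c'.
Proof.
move=> /stable_unbounded[u n r] /stable_unbounded[u' n' r'].
have eqx : nfst c = nfst c'.
  case: (ltngtP (nfst c) (nfst c')) => // lt.
    case: u; exists (nsnd c') => v pv; rewrite ltnNge; apply/negP => cv.
    by move: (n' _ _ lt cv); rewrite pv.
  case: u'; exists (nsnd c) => v pv; rewrite ltnNge; apply/negP => cv.
  by move: (n _ _ lt cv); rewrite pv.
rewrite -(npair_nfst_nsnd c) -(npair_nfst_nsnd c') eqx; congr npair.
case: (ltngtP (nsnd c) (nsnd c')) => // lt.
  case: r' => [r0|[x xc px]]; first by rewrite r0 in lt.
  by move: (n x (nsnd c').-1); rewrite eqx px xc => /(_ isT)/implyP;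
    rewrite -ltnS prednK ?lt // (leq_ltn_trans _ lt).
case: r => [r0|[x xc px]]; first by rewrite r0 in lt.
by move: (n' x (nsnd c).-1); rewrite -eqx px xc => /(_ isT)/implyP;
  rewrite -ltnS prednK ?lt // (leq_ltn_trans _ lt).
Qed.

(** Suppose that all runs are finite.  By induction on x, all smaller searches
    are finite, so there is a last run of x.  It is finite and contains all late
    progress of x. *)
Lemma stable_bounded prog :
  (forall c, bounded (stable_progress prog c)) <-> (forall x, bounded (prog x)).
Proof.
split=> [bf x|bp c]; last by apply: sub_bounded (bp (nfst c)) => v /and4P[].
elim/ltn_ind: x => x IH; have [B hB] := bounded_lt IH.
pose quiet r := forall u x', r <= u -> x' < x -> ~~ prog x' u.
have [r qr minr] : exists2 r, quiet r & forall r', quiet r' -> r <= r'.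
  apply: nat_minimal; exists B => u x' Bu x'x; apply/negP => /(hB _ _ x'x).
  by rewrite ltnNge Bu.
have [N hN] := bf (npair x r); exists (maxn N r) => v pv.
rewrite leq_max; case: (leqP r v) => rv; rewrite ?orbT //; apply/orP; left.
apply: hN.
rewrite /stable_progress !npairE pv rv /=; apply/andP; split.
  apply/allP => u _; apply/implyP => ru; apply/allP => x'.
  by rewrite mem_iota => x'x; apply: qr.
case: r qr minr {rv} => //= r qr minr; apply/hasP; apply: contrapT => none.
suff /minr : quiet r by rewrite ltnn.
move=> u x'; rewrite leq_eqVlt => /orP[/eqP <- x'x|]; last exact: qr.
by apply/negP => px; apply: none; exists x'; rewrite // mem_iota.
Qed.

(** The family consists of the runs of the searches for the universal matrix.
    That at most one of its members is infinite is what will make the lattice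
    compactly generated. *)
Theorem Pi03_complete_bounded : exists P : nat -> nat -> pred nat,
  [/\ forall i c v, computable i -> computable c -> computable v ->
        computable_pred (fun u => P (i u) (c u) (v u)),
      forall i c c', ~ bounded (P i c) -> ~ bounded (P i c') -> c = c' &
      forall A, Pi03 A -> exists e, forall n,
        A n <-> forall c, bounded (P (npair e n) c)].
Proof.
have [Q cQ QA] := universal_Pi03.
exists (fun i => stable_progress (fun x => progress (Q i x))); split.
- have cgood i x y s : computable i -> computable x -> computable y ->
      computable s ->
      computable_pred (fun u => witnessed (Q (i u) (x u)) (y u) (s u)).
    by move=> ci cx cy cs; rewrite /witnessed; computability.
  have cprog i x v : computable i -> computable x -> computable v ->
      computable_pred (fun u => progress (Q (i u) (x u)) (v u)).
    by move=> ci cx cv; rewrite /progress; computability.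
  by move=> i c v ci cc cv; rewrite /stable_progress; computability.
- by move=> i c c'; apply: stable_unbounded_unique.
- move=> A /QA [e eA]; exists e => n; rewrite eA stable_bounded.
  by split=> h x; apply/progress_bounded/h.
Qed.

Local Open Scope classical_set_scope.


(** * Coding of finitely supported sequences *)

(** Reading a number as the pair of its head and the code of its tail makes each
    number a sequence.  As the second projection decreases, down to the fixed
    point 0, this is a bijection of the numbers with the sequences that are
    eventually 0. *)
Definition digit m c := nfst (iter c nsnd m).

Lemma nsnd_le m : nsnd m <= m.-1.
Proof.
have := Cantor.to_nat_spec (nfst m) (nsnd m).
rewrite -/(npair _ _) npair_nfst_nsnd; nia.
Qed.

Lemma digit_ge m c : m <= c -> digit m c = 0.
Proof.
move=> mc; rewrite /digit; suff /eqP -> : iter c nsnd m == 0.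
  by have := nfst_le 0; rewrite leqn0 => /eqP.
suff : iter c nsnd m <= m - c by rewrite (eqP mc) leqn0.
elim: c {mc} => [|c IH] /=; first by rewrite subn0.
by have := nsnd_le (iter c nsnd m); lia.
Qed.

Lemma digit_inj m m' : digit m =1 digit m' -> m = m'.
Proof.
elim: {m m'}(m + m').+1 {-2}m {-2}m' (ltnSn (m + m')) => // N IH m m' lt eqd.
have eqS : digit (nsnd m) =1 digit (nsnd m').
  by move=> c; have := eqd c.+1; rewrite /digit !iterSr.
have [/eqP|pos] := posnP (m + m').
  by rewrite addn_eq0 => /andP[/eqP-> /eqP->].
rewrite -(npair_nfst_nsnd m) -(npair_nfst_nsnd m') (eqd 0 : nfst m = nfst m').
congr npair; apply: IH eqS; have := nsnd_le m; have := nsnd_le m'; lia.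
Qed.

Fixpoint encode n (f : nat -> nat) :=
  if n is n'.+1 then npair (f 0) (encode n' (f \o succn)) else 0.

Lemma digit_encode n f :
  (forall c, n <= c -> f c = 0) -> digit (encode n f) =1 f.
Proof.
elim: n f => [|n IH] f f0 c /=; first by rewrite digit_ge // f0.
case: c => [|c]; first by rewrite /digit /= nfst_npair.
rewrite /digit iterSr nsnd_npair -/(digit _ _) IH // => k nk.
exact: f0.
Qed.

(** * Columns *)

(** The column order for p: v in p stands for the integer v and v outside p for
    the integer -(v + 1). *)
Definition col_lt (p : pred nat) v u :=
  if p u then p v ==> (v < u) else ~~ p v && (u < v).

Lemma col_lt_irr p v : col_lt p v v = false.
Proof. by rewrite /col_lt ltnn; case: (p v). Qed.

Lemma col_lt_total p v u : ~~ col_lt p v u -> ~~ col_lt p u v -> v = u.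
Proof. rewrite /col_lt; case: (p u); case: (p v) => //=; lia. Qed.

Lemma col_lt_le_trans p v u w : col_lt p u v -> ~~ col_lt p w v -> col_lt p u w.
Proof. rewrite /col_lt; case: (p u); case: (p v); case: (p w) => //=; lia. Qed.

Lemma col_le_lt_trans p v u w : ~~ col_lt p v u -> col_lt p v w -> col_lt p u w.
Proof. rewrite /col_lt; case: (p u); case: (p v); case: (p w) => //=; lia. Qed.

(** An order of this kind has a greatest element in every nonempty set that is
    bounded above; only elements of p can be unboundedly high. *)
Lemma col_max (p : pred nat) (D : set nat) : D !=set0 ->
  (exists N, forall v, D v -> p v -> v <= N) ->
  exists2 t, D t & forall v, D v -> ~~ col_lt p t v.
Proof.
move=> [v0 Dv0] [N hN].
have [[v1 [Dv1 pv1]]|none] := pselect (exists v, D v /\ p v).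
  have ex : exists v, `[< D v /\ p v >] by exists v1; apply/asboolP.
  have ub v : `[< D v /\ p v >] -> v <= N by move=> /asboolP[/hN h /h].
  case: (ex_maxnP ex ub) => t /asboolP[Dt contains] maxt; exists t => // v Dv.
  rewrite /col_lt; case: ifP => [pv|]; last by rewrite contains.
  by rewrite contains /= -leqNgt; apply: maxt; apply/asboolP.
have [t Dt mint] := nat_minimal (ex_intro D v0 Dv0); exists t => // v Dv.
have npv u : D u -> p u = false.
  by move=> Du; apply/negP => pu; apply: none; exists u.
by rewrite /col_lt !npv //= -leqNgt mint.
Qed.

(** The digit 0 stands for the column in full, and u + 1 for its initial segment
    below the point u.  The strict inequality keeps the full column different
    from every initial segment, even if the column has a greatest point; the
    successor makes 0 the default, as all but finitely many digits are 0. *)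
Definition below p d v := (d == 0) || col_lt p v d.-1.

Definition digit_le p d d' := (d' == 0) || (d != 0) && ~~ col_lt p d'.-1 d.-1.

Lemma digit_leP p d d' :
  reflect (forall v, below p d v -> below p d' v) (digit_le p d d').
Proof.
apply: (iffP idP) => [|h]; rewrite /digit_le /below.
  case: d' => [|d'] //; case: d => [|d] //= h v vd; exact: col_lt_le_trans vd h.
have := h d'.-1; rewrite /below; case: d' {h} => [|d'] //=; rewrite col_lt_irr.
by case: d => [|d] //=; [move/(_ isT)|case: col_lt => // /(_ isT)].
Qed.

Lemma digit_le_total p d d' : ~~ digit_le p d d' -> digit_le p d' d.
Proof.
rewrite /digit_le /col_lt; case: d => [|d]; case: d' => [|d'] //=.
by case: (p d); case: (p d') => //=; lia.
Qed.

Lemma below_inj p d d' : below p d =1 below p d' -> d = d'.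
Proof.
move=> eqb; have : digit_le p d d' && digit_le p d' d.
  by apply/andP; split; apply/digit_leP => v; rewrite eqb.
rewrite /digit_le; case: d {eqb} => [|d]; case: d' => [|d'] //=.
by case/andP => h h'; congr S; apply: col_lt_total h' h.
Qed.

Definition digit_min p d d' := if digit_le p d d' then d else d'.
Definition digit_max p d d' := if digit_le p d d' then d' else d.

Lemma below_digit_min p d d' v :
  below p (digit_min p d d') v = below p d v && below p d' v.
Proof.
rewrite /digit_min.
case: ifPn => [/digit_leP/(_ v)|/digit_le_total/digit_leP/(_ v)];
  by case: below; case: below => // /(_ isT).
Qed.

Lemma below_digit_max p d d' v :
  below p (digit_max p d d') v = below p d v || below p d' v.
Proof.
rewrite /digit_max.
case: ifPn => [/digit_leP/(_ v)|/digit_le_total/digit_leP/(_ v)];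
  by case: below; case: below => // /(_ isT).
Qed.

(** If the cuts of D have no greatest one, then they are unbounded in p and
    hence exceed each point: the union is the column in full. *)
Lemma sup_digit p (D : set nat) : D !=set0 ->
  exists d, forall v, below p d v <-> exists2 d', D d' & below p d' v.
Proof.
move=> [d0 Dd0]; have [D0|nD0] := pselect (D 0).
  by exists 0 => v; split=> // _; exists 0.
pose U := [set u | D u.+1].
have DU d : D d -> exists2 u, d = u.+1 & U u.
  by case: d => // u Du; exists u.
have [u0 _ Uu0] := DU _ Dd0.
have [bd|unb] := pselect (exists N, forall v, U v -> p v -> v <= N).
  have [t Ut tmax] := col_max (ex_intro U u0 Uu0) bd.
  exists t.+1 => v; split=> [vt|[d /DU[u -> /tmax tu]]]; first by exists t.+1.
  by rewrite /below /= => vu; apply: col_lt_le_trans vu tu.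
exists 0 => v; split=> // _; apply: contrapT => none; apply: unb.
exists v => u Uu pu; rewrite leqNgt; apply/negP => vu; apply: none.
by exists u.+1; rewrite // /below /col_lt /= pu vu implybT.
Qed.

(** * Open sets *)

Section OpenSets.
Variable P : nat -> nat -> pred nat.

Definition elem n m := (npair n m).+2.

(** The number 0 is the empty set, 1 the whole space, and elem n m the open set
    of level n with cuts given by the digits of m. *)
Definition contains x n c v : bool :=
  match x with
  | 0 => false
  | 1 => true
  | k.+2 => (n < nfst k) || (n == nfst k) && below (P n c) (digit (nsnd k) c) v
  end.

Lemma contains_elem n m n' c v :
  contains (elem n m) n' c v =
  (n' < n) || (n' == n) && below (P n c) (digit m c) v.
Proof. by rewrite /contains /elem !npairE; case: eqP => [->|]. Qed.

Lemma elem_eta k : k.+2 = elem (nfst k) (nsnd k).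
Proof. by rewrite /elem npair_nfst_nsnd. Qed.

Lemma elemP x : [\/ x = 0, x = 1 | exists n m, x = elem n m].
Proof.
case: x => [|[|k]]; [exact: Or31|exact: Or32|apply: Or33].
by exists (nfst k), (nsnd k); apply: elem_eta.
Qed.

(** Digits beyond the sum of the two codes are 0, so a bounded quantifier is
    enough to compare all columns. *)
Definition incl x y :=
  [|| x == 0, y == 1 | [&& x != 1, y != 0 &
    (nfst x.-2 < nfst y.-2) || (nfst x.-2 == nfst y.-2) &&
    all (fun c => digit_le (P (nfst x.-2) c) (digit (nsnd x.-2) c)
                    (digit (nsnd y.-2) c))
      (iota 0 (nsnd x.-2 + nsnd y.-2))]].

Lemma incl_elem n m n' m' : incl (elem n m) (elem n' m') =
  (n < n') || (n == n') &&
    all (fun c => digit_le (P n c) (digit m c) (digit m' c)) (iota 0 (m + m')).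
Proof. by rewrite /incl /= !npairE. Qed.

(** Different levels are separated by column m of the larger one, elem n m,
    because it is not cut there: its digit number m is 0. *)
Lemma inclP x y :
  reflect (forall n c v, contains x n c v -> contains y n c v) (incl x y).
Proof.
case: x y => [|[|k]] [|[|l]]; try by constructor.
- by constructor => /(_ 0 0 0 isT).
- rewrite elem_eta; constructor => /(_ (nfst l).+1 0 0 isT).
  by rewrite contains_elem ltnNge leqnSn gtn_eqF.
- rewrite elem_eta; constructor => /(_ (nfst k) (nsnd k) 0).
  by rewrite contains_elem eqxx digit_ge //= orbT => /(_ isT).
- rewrite !elem_eta incl_elem.
  move: (nfst k) (nsnd k) (nfst l) (nsnd l) => {k l} n m n' m'.
  apply: (iffP idP) => [|h].
    move=> h k c v; rewrite !contains_elem.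
    case: ltngtP h => //= [nn' _|-> /allP h].
      case: (ltngtP k n) => [kn|//|-> _]; first by rewrite (ltn_trans kn nn').
      by rewrite nn'.
    case: (ltngtP k n') => //= _; apply/digit_leP.
    case: (ltnP c (m + m')) => [cm|].
      by apply: h; rewrite mem_iota.
    by move=> cm; rewrite !digit_ge //; lia.
  case: ltngtP => [//|n'n|eqn] /=.
    have := h n m 0; rewrite !contains_elem eqxx digit_ge // orbT => /(_ isT).
    by rewrite ltnNge (ltnW n'n) gtn_eqF.
  apply/allP => c _; apply/digit_leP => v; have := h n c v.
  by rewrite !contains_elem eqn ltnn eqxx.
Qed.

(** All lattice laws follow from this one, as they hold for sets of points. *)
Lemma contains_inj x y :
  (forall n c v, contains x n c v = contains y n c v) -> x = y.
Proof.
move=> h.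
have : incl x y /\ incl y x by split; apply/inclP => n c v; rewrite h.
case: (elemP x) (elemP y) h =>
  [->|->|[n [m ->]]] [->|->|[n' [m' ->]]] h [xy yx] //.
move: xy yx; rewrite !incl_elem; case: ltngtP => //= eqn _ _.
rewrite eqn; congr elem; apply: digit_inj => c.
apply: (@below_inj (P n c)) => v.
by have := h n c v; rewrite !contains_elem eqn ltnn eqxx.
Qed.

Definition inter x y :=
  match x, y with
  | 0, _ | _, 0 => 0
  | 1, z | z, 1 => z
  | k.+2, l.+2 =>
    if nfst k < nfst l then x else if nfst l < nfst k then y else
    elem (nfst k) (encode (nsnd k + nsnd l)
      (fun c => digit_min (P (nfst k) c) (digit (nsnd k) c) (digit (nsnd l) c)))
  end.

Definition union x y :=
  match x, y with
  | 0, z | z, 0 => z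
  | 1, _ | _, 1 => 1
  | k.+2, l.+2 =>
    if nfst k < nfst l then y else if nfst l < nfst k then x else
    elem (nfst k) (encode (nsnd k + nsnd l)
      (fun c => digit_max (P (nfst k) c) (digit (nsnd k) c) (digit (nsnd l) c)))
  end.

Lemma contains_inter x y n c v :
  contains (inter x y) n c v = contains x n c v && contains y n c v.
Proof.
case: x y => [|[|k]] [|[|l]] //=; rewrite ?andbT ?andbF //.
case: ltngtP => [kl|lk|eqn]; last first.
  rewrite contains_elem -eqn; case: ltngtP => //= ->.
  rewrite digit_encode ?below_digit_min // => j lej.
  by rewrite !digit_ge //; lia.
- rewrite /=; case: (ltngtP n (nfst l)) => [nl|_|->] /=;
    rewrite ?lk /= ?andbF //.
  by rewrite (ltn_trans nl lk).
- rewrite /=; case: (ltngtP n (nfst k)) => [nl|_|->] /=;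
    rewrite ?kl /= ?andbT //.
  by rewrite (ltn_trans nl kl).
Qed.

Lemma contains_union x y n c v :
  contains (union x y) n c v = contains x n c v || contains y n c v.
Proof.
case: x y => [|[|k]] [|[|l]] //=; rewrite ?orbT ?orbF //.
case: ltngtP => [kl|lk|eqn]; last first.
  rewrite contains_elem -eqn; case: ltngtP => //= ->.
  rewrite digit_encode ?below_digit_max // => j lej.
  by rewrite !digit_ge //; lia.
- rewrite /=; case: (ltngtP n (nfst l)) => [nl|_|->] /=;
    rewrite ?lk /= ?orbF //.
  by rewrite (ltn_trans nl lk).
- rewrite /=; case: (ltngtP n (nfst k)) => [nl|_|->] /=;
    rewrite ?kl /= ?orbT //.
  by rewrite (ltn_trans nl kl).
Qed.

(** If the levels of the members of S are unbounded, the union is the whole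
    space. Otherwise only the members of the greatest level n matter, and in
    level n the union is formed column by column. A single member already
    contains all but finitely many columns, so the union is cut only in
    finitely many. *)
Lemma union_open (S : set nat) : exists s, forall n c v,
  contains s n c v <-> exists2 x, S x & contains x n c v.
Proof.
have [S1|nS1] := pselect (S 1).
  by exists 1 => n c v; split=> // _; exists 1.
have [[x0 [Sx0 x0N]]|S0] := pselect (exists x, S x /\ x <> 0); last first.
  exists 0 => n c v; split=> // -[x Sx].
  by case: (pselect (x = 0)) => [->//|x0]; case: S0; exists x.
have elS x : S x -> x <> 0 -> exists n m, x = elem n m.
  by move=> Sx xz; case: (elemP x) => // x1; rewrite x1 in Sx.
pose lev n := exists m, S (elem n m).
have [bd|unb] := pselect (exists N, forall n, lev n -> n <= N); last first.
  exists 1 => n c v; split=> // _; apply: contrapT => none; apply: unb.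
  exists n => k [m Skm]; rewrite leqNgt; apply/negP => nk; apply: none.
  by exists (elem k m); rewrite // contains_elem nk.
case: bd => N hN; have [n0 [m0 e0]] := elS _ Sx0 x0N; rewrite {}e0 in Sx0 x0N.
have ex : exists n, `[< lev n >] by exists n0; apply/asboolP; exists m0.
have ub n : `[< lev n >] -> n <= N by move/asboolP/hN.
case: (ex_maxnP ex ub) => n /asboolP[m Snm] maxn {n0 m0 Sx0 x0N ex ub N hN}.
have le_n k m' : S (elem k m') -> k <= n.
  by move=> h; apply: maxn; apply/asboolP; exists m'.
pose D c := [set d | exists2 m', S (elem n m') & d = digit m' c].
have /choice[f hf] c : exists d, forall v, below (P n c) d v <->
    exists2 d', D c d' & below (P n c) d' v.
  by apply: sup_digit; exists (digit m c), m.
have f0 c : m <= c -> f c = 0.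
  move=> mc; apply: (@below_inj (P n c)) => v; rewrite [RHS]/below eqxx.
  by apply/hf; exists 0 => //; exists m; rewrite ?digit_ge.
exists (elem n (encode m f)) => k c v.
rewrite contains_elem digit_encode //; split.
  case/orP => [kn|/andP[/eqP -> /hf[d [m' Sm' ->] dv]]].
    by exists (elem n m); rewrite // contains_elem kn.
  by exists (elem n m'); rewrite // contains_elem ltnn eqxx.
move=> [x Sx px]; have [n' [m' ex]] : exists n m, x = elem n m.
  by apply: elS => // xz; rewrite xz in px.
rewrite {x}ex in Sx px; have := le_n _ _ Sx; move: px; rewrite contains_elem.
rewrite [n' <= n]leq_eqVlt => px /orP[/eqP eqn|lt]; last first.
  by apply/orP; left; case/orP: px => [|/andP[/eqP -> //]]; lia.
rewrite eqn in Sx px; case/orP: px => [->//|/andP[/eqP -> px]].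
by rewrite eqxx ltnn; apply/hf; exists (digit m' c) => //; exists m'.
Qed.
End OpenSets.

(** * The lattice of open sets *)

Definition olattice (P : nat -> nat -> pred nat) : Type := nat.

HB.instance Definition _ P := Choice.copy (olattice P) nat.

Lemma inclE P x y : incl P x y = (inter P x y == x).
Proof.
apply/inclP/eqP => [h|<- n c v]; last by rewrite contains_inter => /andP[].
apply: (@contains_inj P) => n c v; rewrite contains_inter.
by apply: andb_idr; apply: h.
Qed.

Lemma interC P : commutative (inter P).
Proof.
move=> x y; apply: (@contains_inj P) => n c v.
by rewrite !contains_inter andbC.
Qed.

Lemma unionC P : commutative (union P).
Proof.
move=> x y; apply: (@contains_inj P) => n c v.
by rewrite !contains_union orbC.
Qed.

Lemma interA P : associative (inter P).
Proof.
move=> x y z; apply: (@contains_inj P) => n c v.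
by rewrite !contains_inter andbA.
Qed.

Lemma unionA P : associative (union P).
Proof.
move=> x y z; apply: (@contains_inj P) => n c v.
by rewrite !contains_union orbA.
Qed.

Lemma unionKI P y x : inter P x (union P x y) = x.
Proof.
apply: (@contains_inj P) => n c v.
by rewrite contains_inter contains_union; case: (contains P x n c v).
Qed.

Lemma interKU P y x : union P x (inter P x y) = x.
Proof.
apply: (@contains_inj P) => n c v.
by rewrite contains_union contains_inter; case: (contains P x n c v).
Qed.

Lemma interUl P : left_distributive (inter P) (union P).
Proof.
move=> x y z; apply: (@contains_inj P) => n c v.
by rewrite contains_inter !contains_union !contains_inter andb_orl.
Qed.

Lemma interxx P : idempotent_op (inter P).
Proof.
move=> x; apply: (@contains_inj P) => n c v.
by rewrite contains_inter andbb.
Qed.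

HB.instance Definition _ P := Order.isMeetJoinDistrLattice.Build
  (Order.Disp tt tt) (olattice P) (@inclE P) (fun _ _ => erefl)
  (@interC P) (@unionC P) (@interA P) (@unionA P) (@unionKI P) (@interKU P)
  (@interUl P) (@interxx P).

Section Compactness.
Variable P : nat -> nat -> pred nat.
Let L : distrLatticeType _ := olattice P.
Implicit Types (x y s : L) (S : set L).

Lemma le_containsP x y :
  (x <= y)%O <-> forall n c v, contains P x n c v -> contains P y n c v.
Proof. by split=> [/inclP//|h]; apply/inclP. Qed.

Lemma supP S s : supremums S s <->
  forall n c v, contains P s n c v <-> exists2 x, S x & contains P x n c v.
Proof.
split=> [[ub lub] n c v|h].
  have [t tP] := union_open P S; split=> [|[x /ub /le_containsP]]; last exact.
  have : (s <= t)%O.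
    by apply: lub => x Sx; apply/le_containsP => ? ? ? ?; apply/tP; exists x.
  by move=> /le_containsP h /h /tP.
split=> [x Sx|y uby]; apply/le_containsP => n c v.
  by move=> px; apply/h; exists x.
by move=> /h[x /uby /le_containsP]; apply.
Qed.

Lemma supremums_ex S : supremums S !=set0.
Proof. by have [s sP] := union_open P S; exists s; apply/supP. Qed.

Lemma olattice_complete : complete_lattice L.
Proof.
move=> S; split; first exact: supremums_ex.
have [s [ub lub]] := supremums_ex (lbound S); exists s; split.
  by move=> x Sx; apply: lub => y; apply.
by move=> y; apply: ub.
Qed.

(** A finite subset of a directed set has an upper bound in it, so compactness
    gives a single element above x. *)
Lemma compact_directed x S : compact_element x -> S !=set0 ->
  (forall y z, S y -> S z -> exists2 w, S w & (y <= w)%O /\ (z <= w)%O) ->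
  (forall n c v, contains P x n c v -> exists2 y, S y & contains P y n c v) ->
  exists2 y, S y & (x <= y)%O.
Proof.
move=> cx [y0 Sy0] dir cov; have [s sS] := supremums_ex S.
have xs : (x <= s)%O by apply/le_containsP => n c v /cov/(proj1 (supP _ _) sS).
have [S' [/finite_seqP[l S'l] S'S [s' [_ lub] xs']]] := cx _ _ sS xs.
have [y Sy ly] : exists2 y, S y & forall z, z \in l -> (z <= y)%O.
  have : forall z, z \in l -> S z by move=> z zl; apply: S'S; rewrite S'l.
  elim: l {S'l} => [|z l IH] lS; first by exists y0.
  have [y Sy ly] := IH (fun w wl => lS w (mem_behead (s := z :: l) wl)).
  have [w Sw [yw zw]] := dir y z Sy (lS z (mem_head _ _)).
  exists w => // u; rewrite in_cons => /orP[/eqP->//|/ly uy].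
  exact: Order.POrderTheory.le_trans uy yw.
exists y => //; apply: Order.POrderTheory.le_trans xs' _.
by apply: lub => z; rewrite S'l => /ly.
Qed.

(** The predicate that characterizes compactness, stated on codes so that its
    complexity can be read off. *)
Definition compact_cond (x : nat) : Prop :=
  if x is k.+2 then forall c, digit (nsnd k) c = 0 -> bounded (P (nfst k) c)
  else x = 0.

(* The bound m + c.+1 exceeds c and all nonzero digits of m. *)
Definition set_digit m c d := encode (m + c.+1)
  (fun j => if j == c then d else digit m j).

Lemma digit_set_digit m c d j :
  digit (set_digit m c d) j = if j == c then d else digit m j.
Proof.
rewrite digit_encode // => {}j lej; rewrite ifN ?digit_ge //; last by lia.
by apply/eqP; lia.
Qed.

(** Take a member y0 of the cover that contains a point of column m, where m
    codes the cuts of the element of level n; that column is in full. So y0 has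
    at least level n, and it contains the whole element except possibly
    finitely many columns of level n. For each of those columns, the segment to
    be covered has a greatest point or is empty, and a member of the cover that
    contains the greatest point contains the segment. *)
Lemma compact_cond_compact x : compact_cond x -> compact_element x.
Proof.
case: x => [_ S s _ _|[//|k]].
  exists set0; split; [exact: finite_set0|by []|].
  by have [s' s'0] := supremums_ex set0; exists s' => //; apply/le_containsP.
rewrite elem_eta; move: (nfst k) (nsnd k) => n m {k}.
rewrite /compact_cond /elem !npairE -/(elem n m).
move=> bd S s /supP sS /le_containsP xs.
have cov k c v :
    contains P (elem n m) k c v -> exists2 y, S y & contains P y k c v.
  by move=> /xs/sS.
have [y0 Sy0 y0m] : exists2 y, S y & contains P y n m 0.
  by apply: cov; rewrite contains_elem eqxx /below digit_ge // orbT.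
have top c d : (d = 0 -> bounded (P n c)) -> (exists v, below (P n c) d v) ->
    exists2 t, below (P n c) d t &
      forall v, below (P n c) d v -> ~~ col_lt (P n c) t v.
  move=> bdd [v dv]; apply: col_max; first by exists v.
  case: d bdd dv => [/(_ erefl)[N hN] _|u _ _].
    by exists N => w _ /hN/ltnW.
  exists u => w; rewrite /below /col_lt /= => + pw; rewrite pw /=.
  by case: ifP => // _ /ltnW.
have pick c : exists2 y, S y &
    forall v, contains P (elem n m) n c v -> contains P y n c v.
  have [ex|none] := pselect (exists v, below (P n c) (digit m c) v); last first.
    exists y0 => // v; rewrite contains_elem ltnn eqxx /= => dv.
    by case: none; exists v.
  have [t mt tmax] := top _ _ (bd c) ex.
  have [y Sy yt] : exists2 y, S y & contains P y n c t.
    by apply: cov; rewrite contains_elem eqxx mt orbT.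
  exists y => // v; rewrite contains_elem ltnn eqxx /= => /tmax vt.
  case: y {Sy} yt => [|[|k]] //=; case/orP => [->//|/andP[-> /= yt]].
  apply/orP; right; move: yt; rewrite /below; case: eqP => //= _ yt.
  exact: col_le_lt_trans vt yt.
have [ys hys] := choice (fun c => let: ex_intro2 y Sy yP := pick c in
  ex_intro (fun y => S y /\
      forall v, contains P (elem n m) n c v -> contains P y n c v)
    y (conj Sy yP)).
have [B hB] : exists B, forall k c v, B <= c -> contains P (elem n m) k c v ->
    contains P y0 k c v.
  case: y0 {Sy0} y0m => [//|[_|k h]]; first by exists 0.
  exists (nsnd k) => i c v kc.
  rewrite contains_elem [contains _ _.+2 _ _ _]/= (digit_ge kc).
  rewrite [X in _ && X]/= andbT.
  rewrite /= in h; case/orP: h => [nk|/andP[/eqP nk _]].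
    by case/orP => [/ltn_trans ->|/andP[/eqP ->]]; rewrite ?nk.
  by rewrite -nk; case/orP => [->|/andP[->]]; rewrite ?orbT.
have low k c v : k < n -> contains P y0 k c v.
  case: y0 {Sy0 hB} y0m => [|[|j]] //= h kn.
  case/orP: h => [nj|/andP[/eqP <- _]]; last by rewrite kn.
  by rewrite (ltn_trans kn nj).
pose l := y0 :: [seq ys c | c <- iota 0 B].
exists [set` l]; split; first exact: finite_seq.
  move=> y /=; rewrite in_cons => /orP[/eqP ->//|/mapP[c _ ->]].
  exact: (hys c).1.
have [s' ss'] := supremums_ex [set` l]; exists s' => //; move/supP: ss' => ss'.
apply/le_containsP => k c v px; apply/ss'.
have [Bc|cB] := leqP B c.
  by exists y0; [rewrite /= mem_head|exact: hB].
have := px; rewrite contains_elem; case/orP => [kn|/andP[/eqP kn _]].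
  by exists y0; [rewrite /= mem_head|exact: low].
exists (ys c); first by rewrite /= in_cons map_f ?orbT // mem_iota.
by rewrite kn in px *; apply: (hys c).2.
Qed.

Lemma contains_elem0 n k c v : contains P (elem n 0) k c v = (k <= n).
Proof.
by rewrite contains_elem /below digit_ge // andbT [RHS]leq_eqVlt orbC.
Qed.

(** The whole space is the union of the increasing sets that fill complete
    levels. An element with an infinite column in full is the directed union of
    the sets obtained by cutting this column at the points u of P n c. *)
Lemma compact_compact_cond x : compact_element x -> compact_cond x.
Proof.
move=> cx; case: (elemP x) cx => [->//|->|[n [m ->]]] cx.
  have [|||y [n _ ->] /le_containsP/(_ n.+1 0 0)] :=
    @compact_directed _ [set y | exists2 n, True & y = elem n 0] cx.
  - by exists (elem 0 0), 0.
  - move=> _ _ [i _ ->] [j _ ->]; exists (elem (maxn i j) 0).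
      by exists (maxn i j).
    by split; apply/le_containsP => n c v;
      rewrite !contains_elem0 leq_max => ->; rewrite ?orbT.
  - by move=> n c v _; exists (elem n 0); [exists n|rewrite contains_elem0].
  - by rewrite contains_elem0 ltnn => /(_ isT).
rewrite /compact_cond /elem !npairE -/(elem n m) => c mc.
apply: contrapT => unb.
have big N : exists2 u, P n c u & N <= u.
  apply: contrapT => none; apply: unb; exists N => v pv; rewrite ltnNge.
  by apply/negP => Nv; apply: none; exists v.
pose e u := elem n (set_digit m c u.+1).
have pt_e u k j v : contains P (e u) k j v =
    if (k == n) && (j == c) then col_lt (P n c) v u
    else contains P (elem n m) k j v.
  rewrite !contains_elem digit_set_digit.
  by case: eqP => [->|_] //=; rewrite ltnn; case: eqP => [->|_].
have [|||y [u pu ->]] :=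
  @compact_directed _ [set y | exists2 u, P n c u & y = e u] cx.
- by have [u pu _] := big 0; exists (e u), u.
- move=> _ _ [u pu ->] [u' pu' ->]; exists (e (maxn u u')).
    by exists (maxn u u') => //; case: (leqP u u').
  have mono w w' k j v : P n c w -> P n c w' -> w <= w' ->
      contains P (e w) k j v -> contains P (e w') k j v.
    move=> pw pw' ww'; rewrite !pt_e; case: ifP => // _.
    by rewrite /col_lt pw pw'; case: (P n c v) => //=; lia.
  by split; apply/le_containsP => k j v; apply: mono;
    rewrite ?leq_max ?leqnn ?orbT //; case: (leqP u u').
- move=> k j v px; have [u pu vu] := big v.+1; exists (e u); first by exists u.
  by rewrite pt_e px /col_lt pu vu implybT if_same.
move/le_containsP/(_ n c u); rewrite pt_e !eqxx col_lt_irr => h.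
by apply: notF; apply: h; rewrite contains_elem /below mc eqxx orbT.
Qed.

Lemma compact_elementP x : compact_element x <-> compact_cond x.
Proof. by split; [apply: compact_compact_cond|apply: compact_cond_compact]. Qed.

(** A point of a noncompact element of level n lies in the compact set
    obtained by cutting its only infinite column above that point.  Points of
    the whole space lie in a complete level, to which this applies. *)
Lemma olattice_compactly_generated :
  (forall n c c', ~ bounded (P n c) -> ~ bounded (P n c') -> c = c') ->
  compactly_generated L.
Proof.
move=> uniqP x.
have gen n m k c v : contains P (elem n m) k c v ->
    exists2 y : L, compact_element y &
    (y <= (elem n m : L))%O /\ contains P y k c v.
  move=> pv; have [bd|/existsNP[c0 unb]] := pselect (forall c, bounded (P n c)).
    exists (elem n m) => //; apply/compact_elementP.
    by rewrite /compact_cond /elem !npairE => j _; apply: bd.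
  have bd j : j <> c0 -> bounded (P n j).
    by move=> jc; apply: contrapT => unbj; apply: jc; apply: uniqP unbj unb.
  have [mc|mc] := eqVneq (digit m c0) 0; last first.
    exists (elem n m) => //; apply/compact_elementP.
    rewrite /compact_cond /elem !npairE => j mj; apply: bd => jc.
    by rewrite jc in mj; rewrite mj eqxx in mc.
  have [u pu vu] : exists2 u, P n c0 u & v < u.
    apply: contrapT => none; apply: unb; exists v.+1 => w pw; rewrite ltnNge.
    by apply/negP => vw; apply: none; exists w.
  exists (elem n (set_digit m c0 u.+1)).
    apply/compact_elementP; rewrite /compact_cond /elem !npairE => j.
    by rewrite digit_set_digit; case: eqP => // /bd.
  split.
    apply/le_containsP => i j w; rewrite !contains_elem digit_set_digit.
    case: (eqVneq j c0) => [->|//]; rewrite mc.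
    by case: (i < n) => //= /andP[->].
  move: pv; rewrite !contains_elem digit_set_digit.
  case: (eqVneq c c0) => [->|//]; case: (k < n) => //= /andP[-> _].
  by rewrite /below /col_lt /= pu vu implybT.
exists [set y | compact_element y /\ (y <= x)%O]; first by move=> y [].
apply/supP => n c v; split=> [px|[y [_ /le_containsP]]]; last exact.
case: (elemP x) px => [->//|->|[k [m ->]]] px.
  have [|y cy [_ py]] := @gen n 0 n c v; first by rewrite contains_elem0.
  by exists y => //; split=> //; apply/le_containsP.
by have [y cy [yx py]] := gen _ _ _ _ _ px; exists y.
Qed.

Lemma olattice_algebraic :
  (forall n c c', ~ bounded (P n c) -> ~ bounded (P n c') -> c = c') ->
  algebraic_lattice L.
Proof.
by split; [exact: olattice_complete|exact: olattice_compactly_generated].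
Qed.
End Compactness.

(** * Complexity of the lattice *)

Lemma computable_digit m c :
  computable m -> computable c -> computable (fun x => digit (m x) (c x)).
Proof. by move=> cm cc; rewrite /digit; computability. Qed.
#[local] Hint Resolve computable_digit : computability.

Section Effectiveness.
Variable P : nat -> nat -> pred nat.
Hypothesis computable_P : forall n c v,
  computable n -> computable c -> computable v ->
  computable_pred (fun u => P (n u) (c u) (v u)).

Lemma computable_incl : computable_rel (incl P).
Proof.
rewrite /computable_rel /incl /digit_le /col_lt.
computability.
Qed.

Lemma Pi03_compact_cond : Pi03 [set x | compact_cond P x].
Proof.
exists (fun w => let x := nfst w in let c := nfst (nsnd w) in
  let N := nfst (nsnd (nsnd w)) in let v := nsnd (nsnd (nsnd w)) in
  (x == 0) || (x != 1) &&
    ((digit (nsnd x.-2) c == 0) ==> P (nfst x.-2) c v ==> (v < N))).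
  computability.
move=> [|[|k]] /=; rewrite ?npairE.
- by split=> // _ x; exists 0 => z; rewrite !npairE.
- by split=> // /(_ 0)[y /(_ 0)]; rewrite !npairE.
- split=> h c.
    have [dc|dc] := eqVneq (digit (nsnd k) c) 0; last first.
      by exists 0 => v; rewrite !npairE /= (negbTE dc).
    have [N hN] := h c dc; exists N => v; rewrite !npairE /= dc.
    by rewrite implyTb; apply/implyP => /hN.
  move=> dc; have [N hN] := h c; exists N => v pv.
  by have := hN v; rewrite !npairE /= dc pv.
Qed.
End Effectiveness.

Theorem theorem5p5 :
  exists (d : Order.disp_t) (K : Order.DistrLattice.axioms_ d nat),
    let L : distrLatticeType d := Order.DistrLattice.Pack K in
    [/\ computable_rel (fun x y : nat => ((x : L) <= (y : L))%O),
        algebraic_lattice L &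
        Pi03_complete [set x : nat | compact_element (x : L)]].
Proof.
have [P [cP uniqP PA]] := Pi03_complete_bounded.
exists _, (Order.DistrLattice.class (olattice P)) => L.
have compactE :
    [set x : nat | compact_element (x : L)] = [set x | compact_cond P x].
  by apply/seteqP; split=> x /compact_elementP.
split; first exact: computable_incl.
  exact: olattice_algebraic.
rewrite compactE; split; first exact: Pi03_compact_cond.
(* The element that contains level npair e n in full: all its digits are 0. *)
move=> A /PA[e eA]; exists (fun n => elem (npair e n) 0).
  by rewrite /elem; computability.
move=> n; rewrite eA /= !npairE; split=> h c; first by move=> _; apply: h.
by apply: h; apply: digit_ge.
Qed.
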